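(* Let $\mathbb{P}$ be a semifield, let $(B,\mathbf{x},\mathbf{y})$ be a seed over $\mathbb{P}$, and let $\mathbb{A}$ be a ground ring with $\mathbb{Z}\subseteq\mathbb{A}\subseteq\mathbb{Z}\mathbb{P}$ satisfying the standing assumptions (i) and (ii) of the context. If $(B,\mathbf{x},\mathbf{y})$ is an acyclic source freezing seed with respect to $\mathbb{A}$, then the cluster algebra and the upper cluster algebra over $\mathbb{A}$ coincide: $\mathcal{A}_{\mathbb{A}}(B,\mathbf{x},\mathbf{y})=\mathcal{U}_{\mathbb{A}}(B,\mathbf{x},\mathbf{y})$.
   Context: A semifield $\mathbb{P}$ is a torsion-free abelian group, written multiplicatively, with an auxiliary addition $\oplus$ that is commutative, associative and distributive over the multiplication. $\mathbb{Z}\mathbb{P}$ is its group ring. Let $\mathcal{F}$ be a field containing $\mathbb{Z}\mathbb{P}$. A seed of rank $n$ in $\mathcal{F}$ is a triple $(B,\mathbf{x},\mathbf{y})$ where $\mathbf{x}=(x_1,\dots,x_n)$ (the cluster) is an $n$-tuple in $\mathcal{F}$ freely generating $\mathcal{F}$ as a field over the fraction field of $\mathbb{Z}\mathbb{P}$, $\mathbf{y}=(y_1,\dots,y_n)$ (the coefficients) is an $n$-tuple in $\mathbb{P}$, and $B$ (the exchange matrix) is an integral skew-symmetrizable $n\times n$ matrix. Mutation. Write $[a]_+=\max(a,0)$. For $1\le k\le n$ the mutation of a seed in direction $k$ is the seed $(\mu_k(B),\mu_k(\mathbf{x}),\mu_k(\mathbf{y}))$, where $\mu_k(\mathbf{x})$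 is obtained from $\mathbf{x}$ by replacing $x_k$ with $x_k'=\dfrac{y_k\prod_j x_j^{[B_{jk}]_+}+\prod_j x_j^{[-B_{jk}]_+}}{(y_k\oplus 1)x_k}$; $\mu_k(\mathbf{y})=(y_1',\dots,y_n')$ with $y_k'=y_k^{-1}$ and $y_i'=y_iy_k^{[B_{ki}]_+}(y_k\oplus 1)^{-B_{ki}}$ for $i\ne k$; and $\mu_k(B)_{ij}=-B_{ij}$ if $i=k$ or $j=k$, and $\mu_k(B)_{ij}=B_{ij}+\frac12(|B_{ik}|B_{kj}+B_{ik}|B_{kj}|)$ otherwise. Two seeds are mutation equivalent if one is obtained from the other by a sequence of mutations, up to permuting indices. Cluster algebras. The cluster variables are the elements of the clusters of all seeds mutation equivalent to $(B,\mathbf{x},\mathbf{y})$. For a ground ring $\mathbb{Z}\subseteq\mathbb{A}\subseteq\mathbb{Z}\mathbb{P}$, the cluster algebra $\mathcal{A}=\mathcal{A}_{\mathbb{A}}(B,\mathbf{x},\mathbf{y})$ is the unital $\mathbb{A}$-subalgebra of $\mathcal{F}$ generated by all cluster variables, and the upper cluster algebra is $\mathcal{U}=\mathcal{U}_{\mathbb{A}}(B,\mathbf{x},\mathbf{y})=\bigcap \mathbb{A}[(x_1')^{\pm1},\dots,(x_n')^{\pm1}]$, the intersection over all clusters $(x_1',\dots,x_n')$ of seeds mutation equivalent to $(B,\mathbf{x},\mathbf{y})$. Standing assumptions on $\mathbb{A}$. For every seed $(B',\mathbf{x}',\mathbf{y}')$ mutation equivalent to the given one: (i) (Laurent phenomenon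 over $\mathbb{A}$) $\mathcal{A}\subseteq\mathcal{A}[(x_1')^{-1},\dots,(x_n')^{-1}]=\mathbb{A}[(x_1')^{\pm1},\dots,(x_n')^{\pm1}]$; (ii) $\frac{y_i'}{1\oplus y_i'},\frac{1}{1\oplus y_i'}\in\mathbb{A}$ for all $i$. A seed $(B,\mathbf{x},\mathbf{y})$ is acyclic if there are no indices $i_1,\dots,i_\ell\in\{1,\dots,n\}$ ($\ell\geq 2$) with $B_{i_{j+1}i_j}>0$ for $1\le j<\ell$ and $i_1=i_\ell$. A seed $(B,\mathbf{x},\mathbf{y})$ is a source freezing seed with respect to $\mathbb{A}$ if $y_i\oplus 1\in\mathbb{A}$ for all $1\le i\le n$. *)

(* Defs.v *)
From HB Require Import structures.
From mathcomp Require Import all_boot all_order all_algebra.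
From mathcomp Require Import perm finmap.
From mathcomp Require Import boolp classical_sets.
From mathcomp Require monalg mpoly.

Set Implicit Arguments.
Unset Strict Implicit.
Unset Printing Implicit Defensive.

Import Order.TTheory GRing.Theory Num.Theory.

Local Open Scope classical_set_scope.
Local Open Scope ring_scope.

HB.mixin Record Group_isSemifield P of monoid.Group P := {
  sfmulC : commutative (@monoid.mul P);
  sf_torsion_free : forall (x : P) (m : nat),
    (0 < m)%N -> (x ^+ m)%g = 1%g -> x = 1%g;
  oplus : P -> P -> P;
  oplusC : commutative oplus;
  oplusA : associative oplus;
  mul_oplusr : right_distributive (@monoid.mul P) oplus
}.

#[short(type="semifieldType")]
HB.structure Definition Semifield :=
  {P of Group_isSemifield P & monoid.Group P}.

Definition expgz (G : groupType) (x : G) (m : int) : G :=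
  match m with
  | Posz k => (x ^+ k)%g
  | Negz k => (x ^- k.+1)%g
  end.

(* monalg and mpoly declare clashing notations, so each is imported only in the
   section that uses it. *)
Section GroupRing.
Import monalg.
Context (G : groupType).

(* monalg makes {malg int[K]} a ring only when K has no invertible element
   besides 1, hence not for a group; we put the convolution product on it. *)
Definition group_ring : Type := {malg int[G]}.

HB.instance Definition _ := GRing.Zmodule.on group_ring.

Implicit Types (f g h : group_ring) (x y : G).

Definition grU x : group_ring := << x >>.

Definition gr_mul f g : group_ring :=
  \sum_(x <- msupp f) \sum_(y <- msupp g) << f@_x * g@_y *g (x * y)%g >>.

Lemma gr_mulw (d1 d2 : {fset G}) f g :
  (msupp f `<=` d1)%fset -> (msupp g `<=` d2)%fset ->
  gr_mul f g = \sum_(x <- d1) \sum_(y <- d2) << f@_x * g@_y *g (x * y)%g >>.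
Proof.
move=> le1 le2; rewrite /gr_mul (big_fset_incl _ le1) /=.
  apply: eq_bigr => x _; apply: big_fset_incl => // y _ /mcoeff_outdom ->.
  by rewrite mulr0 monalgU0.
move=> x _ /mcoeff_outdom fx.
by rewrite big1 // => y _; rewrite fx mul0r monalgU0.
Qed.

Lemma gr_mulUg (c : int) x g :
  gr_mul << c *g x >> g = \sum_(y <- msupp g) << c * g@_y *g (x * y)%g >>.
Proof.
rewrite (gr_mulw msuppU_le (fsubset_refl _)) big_seq_fset1.
by apply: eq_bigr => y _; rewrite mcoeffUU.
Qed.

Lemma gr_mulgU (c : int) x g :
  gr_mul g << c *g x >> = \sum_(y <- msupp g) << g@_y * c *g (y * x)%g >>.
Proof.
rewrite (gr_mulw (fsubset_refl _) msuppU_le).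
by apply: eq_bigr => y _; rewrite big_seq_fset1 mcoeffUU.
Qed.

Lemma gr_mulUU (c d : int) x y :
  gr_mul << c *g x >> << d *g y >> = << c * d *g (x * y)%g >>.
Proof. by rewrite (gr_mulw msuppU_le msuppU_le) !big_seq_fset1 !mcoeffUU. Qed.

Lemma gr_mul0g : left_zero 0 gr_mul.
Proof. by move=> g; rewrite /gr_mul msupp0 big_seq_fset0. Qed.

Lemma gr_mulg0 : right_zero 0 gr_mul.
Proof.
by move=> g; rewrite /gr_mul big1 // => x _; rewrite msupp0 big_seq_fset0.
Qed.

Lemma gr_mulEl f g : gr_mul f g = \sum_(x <- msupp f) gr_mul << f@_x *g x >> g.
Proof. by apply: eq_bigr => x _; rewrite gr_mulUg. Qed.

Lemma gr_mulEr f g : gr_mul f g = \sum_(y <- msupp g) gr_mul f << g@_y *g y >>.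
Proof.
by rewrite [LHS]exchange_big; apply: eq_bigr => y _; rewrite gr_mulgU.
Qed.

Lemma gr_mul1g : left_id (grU 1%g) gr_mul.
Proof.
move=> g; rewrite gr_mulUg [RHS]monalgE.
by apply: eq_bigr => y _; rewrite mul1r mul1g.
Qed.

Lemma gr_mulg1 : right_id (grU 1%g) gr_mul.
Proof.
move=> g; rewrite gr_mulgU [RHS]monalgE.
by apply: eq_bigr => y _; rewrite mulr1 mulg1.
Qed.

Lemma gr_mulDl : left_distributive gr_mul +%R.
Proof.
move=> f g h.
rewrite (gr_mulw (msuppD_le _ _) (fsubset_refl _)).
rewrite (gr_mulw (fsubsetUl _ (msupp g)) (fsubset_refl _)).
rewrite (gr_mulw (fsubsetUr (msupp f) _) (fsubset_refl _)).
rewrite -big_split /=; apply: eq_bigr => x _.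
rewrite -big_split /=; apply: eq_bigr => y _.
by rewrite mcoeffD mulrDl monalgUD.
Qed.

Lemma gr_mulDr : right_distributive gr_mul +%R.
Proof.
move=> f g h.
rewrite (gr_mulw (fsubset_refl _) (msuppD_le _ _)).
rewrite (gr_mulw (fsubset_refl _) (fsubsetUl _ (msupp h))).
rewrite (gr_mulw (fsubset_refl _) (fsubsetUr (msupp g) _)).
rewrite -big_split /=; apply: eq_bigr => x _.
rewrite -big_split /=; apply: eq_bigr => y _.
by rewrite mcoeffD mulrDr monalgUD.
Qed.

Lemma gr_mulA : associative gr_mul.
Proof.
move=> f g h.
rewrite [RHS](big_morph (gr_mul^~ _) (fun _ _ => gr_mulDl _ _ _) (gr_mul0g _)).
rewrite gr_mulEl; apply: eq_bigr => x _.
rewrite [LHS](big_morph (gr_mul _) (fun _ _ => gr_mulDr _ _ _) (gr_mulg0 _)).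
rewrite [RHS](big_morph (gr_mul^~ _) (fun _ _ => gr_mulDl _ _ _) (gr_mul0g _)).
apply: eq_bigr => y _.
rewrite [LHS](big_morph (gr_mul _) (fun _ _ => gr_mulDr _ _ _) (gr_mulg0 _)).
by rewrite gr_mulEr; apply: eq_bigr => z _; rewrite !gr_mulUU mulrA mulgA.
Qed.

Lemma gr_1neq0 : grU 1%g != 0.
Proof. by apply/eqP => /malgP /(_ 1%g) /eqP; rewrite !mcoeffsE oner_eq0. Qed.

HB.instance Definition _ := GRing.Zmodule_isNzRing.Build (group_ring)
  gr_mulA gr_mul1g gr_mulg1 gr_mulDl gr_mulDr gr_1neq0.

End GroupRing.

Section Subrings.
Context {F : fieldType}.
Implicit Types (R X : set F).

Definition is_subring R : Prop := GRing.subring_closed [pred a | a \in R].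

Definition is_subfield R : Prop := GRing.divring_closed [pred a | a \in R].

Definition adjoin R X : set F := smallest is_subring (R `|` X).

End Subrings.

Section Cluster.
Import mpoly.
Context {P : semifieldType} {F : fieldType} {n : nat}.
(* the inclusion of the group ring of P in the ambient field *)
Variable iota : {rmorphism group_ring P -> F}.

Definition frac_field : set F :=
  [set a | exists p q, q != 0 /\ a = iota p / iota q].

(* The mutation formulas make sense for arbitrary triples; [is_seed] below
   carries the conditions, which mutation preserves. *)
Record seed := Seed {
  exchange : 'M[int]_n;
  cluster : {ffun 'I_n -> F};
  coeffs : {ffun 'I_n -> P}
}.

Definition skew_symmetrizable (B : 'M[int]_n) : Prop :=
  exists d : 'I_n -> int,
    (forall i, 0 < d i) /\ (forall i j, d i * B i j = - (d j * B j i)).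

Definition freely_generates (x : 'I_n -> F) : Prop :=
  (forall p : {mpoly F[n]},
     (forall m, frac_field p@_m) -> p.@[x] = 0 -> p = 0)
  /\ smallest is_subfield (frac_field `|` range x) = setT.

Definition is_seed (s : seed) : Prop :=
  skew_symmetrizable (exchange s) /\ freely_generates (cluster s).

Definition posp (a : int) : int := Num.max a 0.

Definition mutB (k : 'I_n) (B : 'M[int]_n) : 'M[int]_n :=
  \matrix_(i, j)
    if (i == k) || (j == k) then - B i j
    else B i j + ((`|B i k| * B k j + B i k * `|B k j|) %/ 2)%Z.

Definition mutx (k : 'I_n) (s : seed) : {ffun 'I_n -> F} :=
  let: Seed B x y := s in
  [ffun i => if i == k then
      (iota (grU (y k)) * \prod_j x j ^ posp (B j k)
         + \prod_j x j ^ posp (- B j k))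
      / (iota (grU (oplus (y k) 1%g)) * x k)
    else x i].

Definition muty (k : 'I_n) (B : 'M[int]_n) (y : {ffun 'I_n -> P}) :
    {ffun 'I_n -> P} :=
  [ffun i => if i == k then (y k)^-1%g
    else (y i * expgz (y k) (posp (B k i))
            * expgz (oplus (y k) 1%g) (- B k i))%g].

Definition mutate (s : seed) (k : 'I_n) : seed :=
  Seed (mutB k (exchange s)) (mutx k s) (muty k (exchange s) (coeffs s)).

Definition relabel (t : 'S_n) (s : seed) : seed :=
  Seed (\matrix_(i, j) exchange s (t i) (t j))
       [ffun i => cluster s (t i)] [ffun i => coeffs s (t i)].

Definition mutation_class (s : seed) : set seed :=
  [set s' | exists (ks : seq 'I_n) (t : 'S_n),
     s' = relabel t (foldl mutate s ks)].

Variable A : set (group_ring P).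

Definition cluster_algebra (s : seed) : set F :=
  adjoin (iota @` A) (\bigcup_(s' in mutation_class s) range (cluster s')).

Definition laurent_ring (s : seed) : set F :=
  adjoin (iota @` A)
    (range (cluster s) `|` range (fun i => (cluster s i)^-1)).

Definition upper_cluster_algebra (s : seed) : set F :=
  \bigcap_(s' in mutation_class s) laurent_ring s'.

(* A contains the integers since it is a subring. *)
Definition ground_ring : Prop := GRing.subring_closed [pred a | a \in A].

Definition laurent_phenomenon (s : seed) : Prop :=
  forall s', mutation_class s s' ->
    let A' := adjoin (cluster_algebra s) (range (fun i => (cluster s' i)^-1)) in
    cluster_algebra s `<=` A' /\ A' = laurent_ring s'.

Definition coeffs_in_ground (s : seed) : Prop :=
  forall s', mutation_class s s' -> forall i,
    A (grU (coeffs s' i / oplus 1%g (coeffs s' i))%g)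
    /\ A (grU (oplus 1%g (coeffs s' i))^-1%g).

Definition acyclic (s : seed) : Prop :=
  ~ exists (i : 'I_n) (c : seq 'I_n),
      [/\ (0 < size c)%N, path (fun a b => 0 < exchange s b a) i c
        & last i c = i].

Definition source_freezing (s : seed) : Prop :=
  forall i, A (grU (oplus (coeffs s i) 1%g)).

End Cluster.

Arguments seed : clear implicits.

(* Main.v *)
Require Import Defs.
From HB Require Import structures.
From mathcomp Require Import all_boot all_order all_algebra.
From mathcomp Require Import perm.
From mathcomp Require Import boolp classical_sets.
From mathcomp Require mpoly.
From mathcomp Require Import ring.

(** The Laurent phenomenon gives one inclusion. For the other one, let [u] lie
    in the upper cluster algebra and let [R] be the cluster algebra. The elements
    [a] of [R] with [a u] in [R] form an ideal of [R], the conductor of [u], and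
    the point is that its radical is the unit ideal. For a set [Z] of indices
    let [w_Z] be the product of the initial cluster variables [x_j] with [j]
    outside [Z]; by induction on the size of [Z], every [w_Z] lies in the
    radical, and the full set [Z] has [w_Z = 1].

    If there are no arrows inside [Z] (independent set), the mutations at the
    vertices of [Z] do not interact: any subset of them leads to the cluster
    with [x_i] replaced by [x_i' = c_i / x_i] for [i] in the subset, where [c_i]
    involves only variables with index outside [Z]. So [u] is a Laurent
    polynomial in each of these [2^|Z|] clusters. As [x_i] is transcendental
    over the field generated by the other variables, an element of
    [K[x_i, 1/x_i]] and of [K[x_i', 1/x_i']] lies in [K[x_i, x_i']]
    ([laurent_cap]). Applying this to one vertex of [Z] after the other puts [u]
    in the ring generated by the [x_i], [x_i'] for [i] in [Z] and the [x_t],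
    [1/x_t] for [t] outside [Z] ([mixed_ringS]), and a power of [w_Z] clears the
    denominators.

    If there are arrows inside [Z], acyclicity provides a vertex [i] of [Z]
    that is the end of no arrow inside [Z] but the start of an arrow to some
    [j] in [Z] ([acyclic_source]). The exchange relation reads
    [x_i x_i' = p M + q^-1 M'], where [x_j] divides [M], where [M'] only
    involves variables with index outside [Z], and where [q = y_i + 1], the sum being
    that of the semifield, is in the ground ring because the seed is source
    freezing. Hence [w_Z M'] is a combination of [w_Z x_i] and [w_Z x_j], which
    are in the radical by induction. Since [M'] divides a power of [w_Z], also
    [w_Z] is in the radical ([conductor_radical_monomial]). *)

Set Implicit Arguments.
Unset Strict Implicit.
Unset Printing Implicit Defensive.

Import Order.TTheory GRing.Theory Num.Theory.

Local Open Scope classical_set_scope.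
Local Open Scope ring_scope.

(** * Subrings of a field *)

(** A predicate carrying the proof of closure, so that the closure lemmas for
    canonical subrings and for [polyOver] apply to subrings given as sets. *)
Definition subring_pred (F : fieldType) (R : set F) (R_subring : is_subring R) :
  {pred F} := [pred a | a \in R].

HB.instance Definition _ (F : fieldType) (R : set F) (HR : is_subring R) :=
  GRing.isSubringClosed.Build F (subring_pred HR) HR.

Section Subrings.
Context {F : fieldType}.
Implicit Types (R X Y : set F) (x a b : F).

Lemma is_subringP R :
  R 1 -> (forall a b, R a -> R b -> R (a - b)) ->
  (forall a b, R a -> R b -> R (a * b)) -> is_subring R.
Proof.
move=> R1 RB RM; split; first exact/mem_set.
- by move=> a b; rewrite !inE; exact: RB.
- by move=> a b; rewrite !inE; exact: RM.
Qed.

Section Closure.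
Context (R : set F) (HR : is_subring R).

Lemma subring_predP a : reflect (R a) (a \in subring_pred HR).
Proof. by rewrite inE /=; apply: (iffP idP) => [/set_mem|/mem_set]. Qed.

Lemma subring0 : R 0. Proof. exact/subring_predP/rpred0. Qed.
Lemma subring1 : R 1. Proof. exact/subring_predP/rpred1. Qed.

Lemma subringD a b : R a -> R b -> R (a + b).
Proof.
by move=> /subring_predP Ra /subring_predP Rb; exact/subring_predP/rpredD.
Qed.

Lemma subringN a : R a -> R (- a).
Proof. by move=> /subring_predP Ra; apply/subring_predP; rewrite rpredN. Qed.

Lemma subringB a b : R a -> R b -> R (a - b).
Proof. by move=> Ra Rb; apply: subringD => //; exact: subringN. Qed.

Lemma subringM a b : R a -> R b -> R (a * b).
Proof.
by move=> /subring_predP Ra /subring_predP Rb; exact/subring_predP/rpredM.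
Qed.

Lemma subringX a m : R a -> R (a ^+ m).
Proof. by move=> /subring_predP Ra; exact/subring_predP/rpredX. Qed.

Lemma subringMn a m : R a -> R (a *+ m).
Proof. by move=> /subring_predP Ra; exact/subring_predP/rpredMn. Qed.

Lemma subring_sum (I : Type) (r : seq I) (Q : pred I) (f : I -> F) :
  (forall i, Q i -> R (f i)) -> R (\sum_(i <- r | Q i) f i).
Proof.
by move=> Rf; apply: (big_ind R) => //; [exact: subring0|exact: subringD].
Qed.

Lemma subring_prod (I : Type) (r : seq I) (Q : pred I) (f : I -> F) :
  (forall i, Q i -> R (f i)) -> R (\prod_(i <- r | Q i) f i).
Proof.
by move=> Rf; apply: (big_ind R) => //; [exact: subring1|exact: subringM].
Qed.

Lemma subring_polyOverP (p : {poly F}) :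
  reflect (forall k, R p`_k) (p \is a polyOver (subring_pred HR)).
Proof. by apply: (iffP polyOverP) => Rp k; exact/subring_predP. Qed.

Lemma subring_horner (p : {poly F}) a : (forall k, R p`_k) -> R a -> R p.[a].
Proof.
move=> /subring_polyOverP Rp /subring_predP Ra; apply/subring_predP.
exact: rpred_horner.
Qed.

End Closure.

Lemma adjoin_subring R X : is_subring (adjoin R X).
Proof.
apply: is_subringP => [|a b Ka Kb|a b Ka Kb] S [HS RXS].
- exact: subring1.
- by apply: subringB => //; [exact: Ka|exact: Kb].
- by apply: subringM => //; [exact: Ka|exact: Kb].
Qed.

Lemma adjoin_base R X : R `<=` adjoin R X.
Proof. by move=> a Ra; apply: sub_gen_smallest; left. Qed.

Lemma adjoin_gen R X : X `<=` adjoin R X.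
Proof. by move=> a Ra; apply: sub_gen_smallest; right. Qed.

Lemma adjoin_min R X Y :
  is_subring Y -> R `<=` Y -> X `<=` Y -> adjoin R X `<=` Y.
Proof.
by move=> HY RY XY; apply: smallest_sub => // a []; [exact: RY|exact: XY].
Qed.

(** The elements whose product with [D] stays in [D] form a subring that
    contains [R] and [X], hence [adjoin R X], and [D] contains [1]. *)
Lemma adjoin_stable R X (D : set F) :
  D 1 -> (forall a b, D a -> D b -> D (a - b)) ->
  (forall r a, R r -> D a -> D (r * a)) ->
  (forall x a, X x -> D a -> D (x * a)) -> adjoin R X `<=` D.
Proof.
move=> D1 DB DR DX u Ku.
suff /(_ u Ku _ D1) : adjoin R X `<=` [set v | forall a, D a -> D (v * a)].
  by rewrite mulr1.
apply: adjoin_min => [|r Rr a|x Xx a]; [|exact: DR|exact: DX].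
apply: is_subringP => /= [a|v w Dv Dw a Da|v w Dv Dw a Da].
- by rewrite mul1r.
- by rewrite mulrBl; apply: DB; [exact: Dv|exact: Dw].
- by rewrite -mulrA; exact/Dv/Dw.
Qed.

End Subrings.

(** * Laurent polynomials in a transcendental element *)

Section Exchange.
Context {F : fieldType}.
Implicit Types (K L E : set F) (x c u a b : F) (p f g : {poly F}).

Definition transcendental L x : Prop :=
  forall p, (forall k, L p`_k) -> p.[x] = 0 -> p = 0.

Lemma transcendental_neq0 L x : is_subring L -> transcendental L x -> x != 0.
Proof.
move=> HL Lx; apply/eqP => x0.
suff /eqP : 'X = 0 :> {poly F} by rewrite polyX_eq0.
by apply: Lx; [apply/(subring_polyOverP HL); exact: polyOverX|rewrite hornerX].
Qed.

(** Such sums are stable under multiplication by [x]: the constant term of [g]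
    moves to the polynomial in [x], and the other terms lose one factor [x^-1].
    Multiplication by [x^-1] is the same with the two parts exchanged. *)
Lemma laurent_split K x u : is_subring K -> x != 0 ->
  adjoin K [set x; x^-1] u ->
  exists f g, [/\ forall k, K f`_k, forall k, K g`_k & u = f.[x] + g.[x^-1]].
Proof.
move=> HK x0.
pose D := [set u | exists f g, [/\ f \is a polyOver (subring_pred HK),
  g \is a polyOver (subring_pred HK) & u = f.[x] + g.[x^-1]]].
have shift (y a : F) f g : y != 0 -> f \is a polyOver (subring_pred HK) ->
    g \is a polyOver (subring_pred HK) -> a = f.[y] + g.[y^-1] ->
    exists f1 g1, [/\ f1 \is a polyOver (subring_pred HK),
      g1 \is a polyOver (subring_pred HK) & y * a = f1.[y] + g1.[y^-1]].
  move=> y0 Kf Kg ->; exists ((f + (g`_0)%:P) * 'X), (drop_poly 1 g); split.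
  - by rewrite rpredM ?polyOverX // rpredD // polyOverC; apply: (polyOverP Kg).
  - by apply/polyOverP => k; rewrite coef_drop_poly; apply: (polyOverP Kg).
  rewrite -{1}(poly_take_drop 1 g) !hornerE.
  have -> : (take_poly 1 g).[y^-1] = g`_0.
    by rewrite /take_poly poly_def big_ord1 hornerZ hornerXn expr0 mulr1.
  by rewrite /=; field.
move=> Ku; suff [f [g [Kf Kg ->]]] : D u.
  by exists f, g; split=> //; exact/subring_polyOverP.
apply: adjoin_stable Ku => [|a b|r a|y a] /=.
- by exists 1, 0; rewrite rpred1 rpred0 hornerC horner0 addr0.
- move=> [f1 [g1 [Kf1 Kg1 ->]]] [f2 [g2 [Kf2 Kg2 ->]]].
  exists (f1 - f2), (g1 - g2); split; rewrite ?rpredB // !hornerD !hornerN.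
  by ring.
- move=> Kr [f [g [Kf Kg ->]]]; exists (r *: f), (r *: g).
  have /subring_predP Kr' := Kr.
  by split; rewrite ?polyOverZ //; [exact/(subring_predP HK)..|
    rewrite !hornerZ mulrDr].
- case=> -> [f [g [Kf Kg Da]]]; first exact: (shift x a f g).
  have := @shift x^-1 a g f; rewrite invrK addrC invr_eq0 => /(_ x0 Kg Kf Da).
  by move=> [g1 [f1 [Kg1 Kf1 ->]]]; exists f1, g1; rewrite addrC.
Qed.

(** Multiplying by [x ^+ size g] turns the relation into a polynomial one whose
    low coefficients are those of [g], in reverse order. *)
Lemma transcendental_laurent0 L x f g : is_subring L -> transcendental L x ->
  (forall k, L f`_k) -> (forall k, L g`_k) -> f.[x] + g.[x^-1] = 0 ->
  g = (g`_0)%:P.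
Proof.
move=> HL Lx Lf Lg fg0.
have x0 := transcendental_neq0 HL Lx.
pose N := size g; pose q := \poly_(j < N.+1) g`_(N - j).
have qx : q.[x] = x ^+ N * g.[x^-1].
  rewrite horner_poly (@horner_coef_wide _ N.+1 g) // mulr_sumr.
  rewrite (reindex_inj rev_ord_inj) /=; apply: eq_bigr => j _.
  have lejN : (j <= N)%N by rewrite -ltnS ltn_ord.
  rewrite subSS subKn // mulrCA; congr (_ * _).
  have -> : x ^+ N = x ^+ (N - j) * x ^+ j by rewrite -exprD subnK.
  by rewrite exprVn mulfK // expf_neq0.
have Lfq : 'X^N * f + q = 0.
  apply: Lx => [|].
    apply/(subring_polyOverP HL); rewrite rpredD ?rpredM ?polyOverXn //.
      exact/subring_polyOverP.
    apply/(subring_polyOverP HL) => k; rewrite coef_poly.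
    by case: ifP => _; [exact: Lg|exact: subring0].
  by rewrite hornerD hornerM hornerXn qx -mulrDr fg0 mulr0.
apply/polyP => -[|k]; rewrite coefC //=.
have [ltkN|] := ltnP k.+1 N; last by move=> leNk; rewrite nth_default.
have := congr1 (fun p : {poly F} => p`_(N - k.+1)) Lfq.
rewrite coefD coefXnM coef0 ltn_subrL /=.
have -> : (0 < N)%N by exact: leq_ltn_trans (leq0n _) ltkN.
by rewrite add0r coef_poly ltnS leq_subr subKn // ltnW.
Qed.

(** Expand [u] as [f(x) + g(1/x)] and, with [x' = c/x], as [f'(1/x') + g'(x')].
    As [1/x' = x/c], comparing over the field [L] leaves no negative power of
    [x] in [g(1/x) - g'(c/x)], so this difference is a constant of [K] and
    [u] is [f(x) + g'(x')] up to that constant. *)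
Lemma laurent_cap K L x c u : is_subring K -> is_subring L ->
  (forall a, L a -> L a^-1) -> K `<=` L -> transcendental L x -> K c ->
  adjoin K [set x; x^-1] u -> adjoin K [set c / x; (c / x)^-1] u ->
  adjoin K [set x; c / x] u.
Proof.
move=> HK HL LV KL Lx Kc Kx Kx'.
have x0 := transcendental_neq0 HL Lx.
have HD := adjoin_subring K [set x; c / x].
have [c0|c0] := eqVneq c 0.
  (* Here [c / x] and its inverse are both zero, so [u] is in [K]. *)
  apply: adjoin_min Kx' => [//||y]; first exact: adjoin_base.
  by rewrite c0 mul0r invr0 => -[] ->; exact: subring0 (adjoin_subring _ _).
have [f [g [Kf Kg uE]]] := laurent_split HK x0 Kx.
have cx0 : c / x != 0 by rewrite mulf_neq0 ?invr_eq0.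
have [g' [f' [Kg' Kf' uE']]] := laurent_split HK cx0 Kx'.
have LP p : (forall k, K p`_k) -> p \is a polyOver (subring_pred HL).
  by move=> Kp; apply/subring_polyOverP => k; exact/KL/Kp.
have Lc : L c by exact: KL.
pose h := f - (f' \Po (c^-1 *: 'X)); pose q := g - (g' \Po (c *: 'X)).
have hx : h.[x] = f.[x] - f'.[(c / x)^-1].
  by rewrite /h hornerD hornerN horner_comp hornerZ hornerX invf_div mulrC.
have qx : q.[x^-1] = g.[x^-1] - g'.[c / x].
  by rewrite /q hornerD hornerN horner_comp hornerZ hornerX.
have qC : q = (q`_0)%:P.
  apply: (@transcendental_laurent0 L x h) => //.
  - apply/(subring_polyOverP HL)/rpredB; first exact: LP.
    apply: polyOver_comp; first exact: LP.
    by rewrite polyOverZ ?polyOverX //; exact/subring_predP/LV.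
  - apply/(subring_polyOverP HL)/rpredB; first exact: LP.
    apply: polyOver_comp; first exact: LP.
    by rewrite polyOverZ ?polyOverX //; exact/subring_predP.
  - rewrite hx qx; have := uE; rewrite uE' => eq_u.
    by apply/eqP; rewrite addrACA -opprD subr_eq0 -eq_u addrC.
have -> : u = f.[x] + g'.[c / x] + q`_0.
  by rewrite uE -[g.[_]](subrK g'.[c / x]) -qx qC hornerC coefC /=; ring.
have base a : K a -> adjoin K [set x; c / x] a by exact: adjoin_base.
apply: (subringD HD); first apply: (subringD HD).
- apply: (subring_horner HD) => [k|]; first exact: base (Kf k).
  by apply: adjoin_gen; left.
- apply: (subring_horner HD) => [k|]; first exact: base (Kg' k).
  by apply: adjoin_gen; right.
suff Kq : q \is a polyOver (subring_pred HK).
  exact: base (subring_polyOverP HK _ Kq 0).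
apply: rpredB; first exact/subring_polyOverP.
apply: polyOver_comp; first exact/subring_polyOverP.
by rewrite polyOverZ ?polyOverX //; exact/subring_predP.
Qed.

Definition fractions E : set F :=
  [set a | exists b d, [/\ E b, E d, d != 0 & a = b / d]].

Lemma fractionsS E : is_subring E -> E `<=` fractions E.
Proof.
move=> HE a Ea; exists a, 1; rewrite oner_neq0 divr1; split=> //.
exact: (subring1 HE).
Qed.

Lemma fractions_subring E : is_subring E -> is_subring (fractions E).
Proof.
move=> HE; apply: is_subringP.
- exact: fractionsS HE _ (subring1 HE).
- move=> _ _ [p [q [Ep Eq q0 ->]]] [p' [q' [Ep' Eq' q0' ->]]].
  exists (p * q' - p' * q), (q * q').
  split; [|exact: (subringM HE)|exact: mulf_neq0|by field; rewrite q0 q0'].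
  by apply: (subringB HE) => //; exact: (subringM HE).
- move=> _ _ [p [q [Ep Eq q0 ->]]] [p' [q' [Ep' Eq' q0' ->]]].
  exists (p * p'), (q * q').
  by split; [exact: (subringM HE)|exact: (subringM HE)|exact: mulf_neq0|
    rewrite mulf_div].
Qed.

Lemma fractionsV E a : is_subring E -> fractions E a -> fractions E a^-1.
Proof.
move=> HE [p [q [Ep Eq q0 ->]]]; have [->|p0] := eqVneq p 0.
  by rewrite mul0r invr0; exact: fractionsS HE _ (subring0 HE).
by exists q, p; rewrite invf_div.
Qed.

(** The coefficients of a polynomial over [fractions E] have a common
    denominator [d] in [E]. *)
Lemma transcendental_fractions E x : is_subring E ->
  transcendental E x -> transcendental (fractions E) x.
Proof.
move=> HE Ex p Lp px0.
suff [d d0 Edp] : exists2 d, d != 0 & forall k, E (d * p`_k).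
  have /eqP : d *: p = 0.
    by apply: Ex => [k|]; rewrite ?coefZ // hornerZ px0 mulr0.
  by rewrite scaler_eq0 (negPf d0) => /eqP.
suff [d [Ed d0 Edp]] : exists d, [/\ E d, d != 0 & forall k, E (d * p`_k)].
  by exists d.
elim/poly_ind: p Lp {px0} => [_|p c IHp Lp].
  by exists 1; rewrite oner_neq0; split=> // [|k]; [exact: (subring1 HE)|
    rewrite coef0 mulr0; exact: (subring0 HE)].
have [k|d [Ed d0 Edp]] := IHp.
  by have := Lp k.+1; rewrite coefD coefMX coefC /= addr0.
have := Lp 0; rewrite coefD coefMX coefC /= add0r => -[a [b [Ea Eb b0 cE]]].
exists (d * b); split; [exact: (subringM HE)|exact: mulf_neq0|].
move=> [|k]; rewrite coefD coefMX coefC /= ?add0r ?addr0; last first.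
  by rewrite mulrAC; exact: (subringM HE).
by rewrite cE mulrA mulrAC mulfK //; exact: (subringM HE).
Qed.

End Exchange.

(** * Transcendence of a cluster variable over the others *)

Section FreeGeneration.
Import mpoly.
Context (P : semifieldType) (F : fieldType) (n : nat).
Context (iota : {rmorphism group_ring P -> F}) (iota_inj : injective iota).

Lemma frac_field_subring : is_subring (frac_field iota).
Proof.
have iota0 (q : group_ring P) : q != 0 -> iota q != 0.
  by apply: contraNneq => iq0; apply/eqP/iota_inj; rewrite iq0 rmorph0.
have iotaM0 (q q' : group_ring P) : q != 0 -> q' != 0 -> q * q' != 0.
  move=> q0 q0'; have : iota (q * q') != 0 by rewrite rmorphM mulf_neq0 ?iota0.
  by apply: contraNneq => ->; rewrite rmorph0.
apply: is_subringP.
- by exists 1, 1; rewrite oner_neq0 rmorph1 divr1.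
- move=> _ _ [p [q [q0 ->]]] [p' [q' [q0' ->]]].
  exists (p * q' - p' * q), (q * q'); split; first exact: iotaM0.
  rewrite rmorphB !rmorphM; field.
  by rewrite !iota0.
- move=> _ _ [p [q [q0 ->]]] [p' [q' [q0' ->]]].
  exists (p * p'), (q * q'); split; first exact: iotaM0.
  by rewrite !rmorphM mulf_div.
Qed.

Lemma frac_field_iota p : frac_field iota (iota p).
Proof. by exists p, 1; rewrite oner_neq0 rmorph1 divr1. Qed.

Variable x : 'I_n -> F.

(** A polynomial in all the variables, seen at the point [x] as a polynomial in
    the [i]-th variable alone. *)
Definition slice (i : 'I_n) : {rmorphism {mpoly F[n]} -> {poly F}} :=
  mmap polyC (fun j => if j == i then 'X else (x j)%:P).

Lemma horner_slice i p : (slice i p).[x i] = p.@[x].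
Proof.
rewrite /slice /= /mmap mevalE horner_sum; apply: eq_bigr => m _.
rewrite hornerM hornerC /mmap1 horner_prod; congr (_ * _).
apply: eq_bigr => j _; rewrite horner_exp.
by case: eqP => [->|_]; rewrite ?hornerX ?hornerC.
Qed.

(** The polynomials in one variable with coefficients in the ring generated by
    the fraction field and the [x j] for [j != i]. Presenting them as slices
    makes free generation apply to them directly. *)
Definition frac_slices (i : 'I_n) : set {poly F} :=
  [set f | exists p : {mpoly F[n]},
     (forall m, frac_field iota p@_m) /\ slice i p = f].

Definition other_polys (i : 'I_n) : set F := [set a | frac_slices i a%:P].

Let HF := frac_field_subring.

Lemma frac_slicesC i a : frac_field iota a -> frac_slices i a%:P.
Proof.
move=> Fa; exists a%:MP; split; last by rewrite /slice /= mmapC.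
move=> m; rewrite mcoeffC; case: eqP => _; rewrite ?mulr1 ?mulr0 //.
exact: (subring0 HF).
Qed.

Lemma frac_slicesX i j :
  frac_slices i (if j == i then 'X else (x j)%:P).
Proof.
exists 'X_j; split; last by rewrite /slice /= mmapX mmap1U.
by move=> m; rewrite mcoeffX; case: eqP => _;
  [exact: (subring1 HF)|exact: (subring0 HF)].
Qed.

Lemma frac_slicesB i f g :
  frac_slices i f -> frac_slices i g -> frac_slices i (f - g).
Proof.
move=> [p [Fp <-]] [q [Fq <-]]; exists (p - q); rewrite rmorphB; split=> // m.
by rewrite mcoeffB; exact: (subringB HF).
Qed.

Lemma frac_slicesM i f g :
  frac_slices i f -> frac_slices i g -> frac_slices i (f * g).
Proof.
move=> [p [Fp <-]] [q [Fq <-]]; exists (p * q); rewrite rmorphM; split=> // m.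
by rewrite mcoeffM; apply: (subring_sum HF) => k _; exact: (subringM HF).
Qed.

Lemma other_polys_subring i : is_subring (other_polys i).
Proof.
apply: is_subringP => [|a b Ea Eb|a b Ea Eb]; rewrite /other_polys /=.
- exact/frac_slicesC/(subring1 HF).
- by rewrite polyCB; exact: frac_slicesB.
- by rewrite polyCM; exact: frac_slicesM.
Qed.

(** A polynomial over [other_polys i] is a slice of some [p], and its value at
    [x i] is the value of [p] at [x]. *)
Lemma transcendental_other i :
  freely_generates iota x -> transcendental (other_polys i) (x i).
Proof.
move=> [xfree _] f Ef fx0.
suff [p [Fp pf]] : frac_slices i f.
  by rewrite -pf (xfree p) ?rmorph0 // -(horner_slice i) pf.
elim/poly_ind: f Ef {fx0} => [_|f c IHf Ef].
  by rewrite -(polyC0); exact/frac_slicesC/(subring0 HF).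
have Ff : frac_slices i f.
  by apply: IHf => k; have := Ef k.+1; rewrite coefD coefMX coefC addr0.
have Fc : frac_slices i c%:P by have := Ef 0; rewrite coefD coefMX coefC add0r.
have FX : frac_slices i 'X by have := frac_slicesX i i; rewrite eqxx.
rewrite -[c%:P]opprK; apply: frac_slicesB; first exact: frac_slicesM.
rewrite -[- _]add0r -polyC0; apply: frac_slicesB Fc.
exact/frac_slicesC/(subring0 HF).
Qed.

Definition other_field (i : 'I_n) : set F := fractions (other_polys i).

Lemma other_field_subring i : is_subring (other_field i).
Proof. exact/fractions_subring/other_polys_subring. Qed.

Lemma other_fieldV i a : other_field i a -> other_field i a^-1.
Proof. exact/fractionsV/other_polys_subring. Qed.

Lemma other_field_iota i p : other_field i (iota p).
Proof.
apply: fractionsS; first exact: other_polys_subring.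
exact/frac_slicesC/frac_field_iota.
Qed.

Lemma other_field_gen i j : j != i -> other_field i (x j).
Proof.
move=> ji; apply: fractionsS; first exact: other_polys_subring.
by have := frac_slicesX i j; rewrite (negPf ji).
Qed.

Lemma transcendental_other_field i :
  freely_generates iota x -> transcendental (other_field i) (x i).
Proof.
move=> /transcendental_other/transcendental_fractions; apply.
exact: other_polys_subring.
Qed.

End FreeGeneration.

(** * The radical of the conductor of an element *)

Section Conductor.
Context {F : fieldType} (R : set F) (HR : is_subring R) (u : F).
Implicit Types a b : F.

(** The radical of the ideal of all [a] in [R] such that [a * u] is in [R]. *)
Definition conductor_radical : set F :=
  [set a | R a /\ exists N, R (a ^+ N * u)].

Lemma conductor_radicalM a b :
  conductor_radical a -> R b -> conductor_radical (a * b).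
Proof.
move=> [Ra [N RN]] Rb; split; first exact: (subringM HR).
exists N; rewrite exprMn mulrAC; apply: (subringM HR) => //.
exact: (subringX HR).
Qed.

Lemma conductor_radicalD a b :
  conductor_radical a -> conductor_radical b -> conductor_radical (a + b).
Proof.
move=> [Ra [N RN]] [Rb [M RM]]; split; first exact: (subringD HR).
exists (N + M)%N; rewrite exprDn mulr_suml; apply: (subring_sum HR) => k _.
rewrite mulrnAl; apply: (subringMn HR).
have [leMk|ltkM] := leqP M k.
  rewrite -(subnK leMk) exprD -!mulrA.
  apply: (subringM HR); first exact: (subringX HR).
  by apply: (subringM HR) => //; exact: (subringX HR).
have leN : (N <= N + M - k)%N by rewrite -addnBA ?leq_addr // ltnW.
rewrite -(subnK leN) exprD.
set d := (_ - N)%N.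
rewrite (_ : _ * u = a ^+ d * b ^+ k * (a ^+ N * u)); last by ring.
by apply: (subringM HR) => //; apply: (subringM HR); exact: (subringX HR).
Qed.

Lemma conductor_radicalX a M :
  R a -> conductor_radical (a ^+ M) -> conductor_radical a.
Proof. by move=> Ra [_ [N RN]]; split=> //; exists (M * N)%N; rewrite exprM. Qed.

Lemma conductor_radical1 : conductor_radical 1 -> R u.
Proof. by move=> [_ [N]]; rewrite expr1n mul1r. Qed.

End Conductor.

(** * Sources of acyclic exchange matrices *)

Lemma posp_gt0 a : 0 < a -> exists m : nat, posp a = m.+1.
Proof. by case: a => [[|m]|m] // _; exists m. Qed.

Lemma posp_le0 a : a <= 0 -> posp a = 0.
Proof. exact: max_r. Qed.

Lemma posp_nat a : exists m : nat, posp a = m.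
Proof. by case: a => m; [exists m|exists 0%N]. Qed.

Section Quiver.
Context {n : nat} (B : 'M[int]_n).

Definition independent (S : {set 'I_n}) : Prop :=
  forall i j, i \in S -> j \in S -> B i j = 0.

Hypothesis B_skew : skew_symmetrizable B.

Lemma skew_symmetrizable_lt0 i j : (B i j < 0) = (0 < B j i).
Proof.
have [d [d0 dB]] := B_skew.
by rewrite -(pmulr_rlt0 _ (d0 i)) -(pmulr_rgt0 _ (d0 j)) dB oppr_lt0.
Qed.

(** With an arrow from [a] to [b] when [B b a > 0], take for [i], among the
    vertices of [Z] with an arrow to [Z], one with as many descendants as
    possible. A predecessor of [i] in [Z] would have the same descendants,
    hence be one of them and close a cycle. *)
Lemma acyclic_source (Z : {set 'I_n}) :
  (forall i c, (0 < size c)%N -> path (fun a b => 0 < B b a) i c ->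
     last i c <> i) ->
  ~ independent Z ->
  exists i j,
    [/\ i \in Z, j \in Z, 0 < B j i & forall k, k \in Z -> 0 <= B k i].
Proof.
move=> acyc notZ; pose e : rel 'I_n := fun a b => 0 < B b a.
pose Q i := (i \in Z) && [exists j in Z, e i j].
have [i0 Qi0] : exists i, Q i.
  have /existsP [i /andP[Zi /existsP[j /andP[Zj Bij]]]] :
      [exists i in Z, [exists j in Z, B i j != 0]].
    apply: contra_notT notZ => noB i j Zi Zj; apply/eqP.
    apply: contraNT noB => Bij; apply/existsP; exists i; rewrite Zi.
    by apply/existsP; exists j; rewrite Zj.
  have [Bn|Bp|B0] := ltgtP (B i j) 0; last by rewrite B0 eqxx in Bij.
  - exists i; rewrite /Q Zi; apply/existsP; exists j.
    by rewrite Zj /e -skew_symmetrizable_lt0.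
  - exists j; rewrite /Q Zj; apply/existsP; exists i.
    by rewrite Zi /e.
case: (arg_maxnP (fun i => #|connect e i|) Qi0) => i.
move=> /andP[Zi /existsP[j /andP[Zj eij]]] imax; exists i, j; split=> // k Zk.
rewrite leNgt skew_symmetrizable_lt0; apply/negP => eki.
have sub : connect e i \subset connect e k.
  by apply/fintype.subsetP => l; apply: connect_trans; exact: connect1.
have Qk : Q k by rewrite /Q Zk; apply/existsP; exists i; rewrite Zi.
have /subset_leqif_card [_ eqc] := sub.
have : connect e i k.
  have : #|connect e i| == #|connect e k|.
    by rewrite eqn_leq (subset_leq_card sub); exact: imax.
  by rewrite eqc => /fintype.subsetP; apply; exact: connect0.
move=> /connectP [p ep kE]; apply: (acyc i (rcons p i)).
- by rewrite size_rcons.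
- by rewrite rcons_path ep -kE.
- by rewrite last_rcons.
Qed.

End Quiver.

(** * Exchange relations *)

Section ExchangeRelation.
Context (P : semifieldType) (F : fieldType) (n : nat).
Context (iota : {rmorphism group_ring P -> F}).
Implicit Types (s : seed P F n) (y z : P) (i j k : 'I_n).

Lemma iota_grUM y z : iota (grU (y * z)%g) = iota (grU y) * iota (grU z).
Proof. by rewrite -rmorphM; congr (iota _); rewrite [RHS]gr_mulUU mulr1. Qed.

Lemma iota_grU1 : iota (grU 1%g) = 1.
Proof. exact: rmorph1. Qed.

Lemma iota_grU_neq0 y : iota (grU y) != 0.
Proof.
have /eqP := iota_grU1; apply: contraTneq => y0.
by rewrite -(mulgV y) iota_grUM y0 mul0r eq_sym oner_neq0.
Qed.

Lemma iota_grUV y : iota (grU y^-1%g) = (iota (grU y))^-1.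
Proof.
apply: (mulfI (iota_grU_neq0 y)).
by rewrite -iota_grUM mulgV iota_grU1 divff ?iota_grU_neq0.
Qed.

Lemma mutxE s k j : mutx iota k s j =
  if j == k then
    (iota (grU (coeffs s k)) * \prod_l cluster s l ^ posp (exchange s l k)
       + \prod_l cluster s l ^ posp (- exchange s l k))
    / (iota (grU (oplus (coeffs s k) 1%g)) * cluster s k)
  else cluster s j.
Proof. by case: s => B x y; rewrite ffunE. Qed.

(** A cluster variable enters its exchange relation only where the column of
    the exchange matrix is nonzero. *)
Lemma eq_mutx s s' k :
  (forall j, exchange s' j k = exchange s j k) -> coeffs s' k = coeffs s k ->
  cluster s' k = cluster s k ->
  (forall j, exchange s j k != 0 -> cluster s' j = cluster s j) ->
  mutx iota k s' k = mutx iota k s k.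
Proof.
move=> eqB eqy eqxk eqx; rewrite !mutxE eqxx eqy eqxk.
congr ((_ * _ + _) / _); apply: eq_bigr => j _; rewrite eqB;
  by have [->|/eqx->] := eqVneq (exchange s j k) 0.
Qed.

Lemma relabel1 s : relabel 1%g s = s.
Proof.
case: s => B x y; congr Seed.
- by apply/matrixP => i j; rewrite mxE !perm1.
- by apply/ffunP => i; rewrite ffunE perm1.
- by apply/ffunP => i; rewrite ffunE perm1.
Qed.

Lemma mutation_class_foldl s ks :
  mutation_class iota s (foldl (mutate iota) s ks).
Proof. by exists ks, 1%g; rewrite relabel1. Qed.

Section Adjacent.
Variable s : seed P F n.
Local Notation B := (exchange s).
Local Notation x := (cluster s).

Definition adjacent i : F := mutx iota i s i.

Definition in_monomial i : F := \prod_j x j ^ posp (B j i).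
Definition out_monomial i : F := \prod_j x j ^ posp (- B j i).

Definition exchange_poly i : F :=
  iota (grU (coeffs s i / oplus 1 (coeffs s i))%g) * in_monomial i
  + iota (grU (oplus 1 (coeffs s i))^-1%g) * out_monomial i.

Lemma adjacentE i : adjacent i = exchange_poly i / x i.
Proof.
rewrite /adjacent mutxE eqxx /exchange_poly iota_grUM iota_grUV oplusC.
rewrite invfM mulrA; congr (_ / _); rewrite mulrDl.
by congr (_ + _); [rewrite mulrAC|rewrite mulrC].
Qed.

Lemma subring_monomial (R : set F) (r : 'I_n -> int) : is_subring R ->
  (forall j, r j != 0 -> R (x j)) -> R (\prod_j x j ^ posp (r j)).
Proof.
move=> HR Rx; apply: (subring_prod HR) => j _.
have [->|rj] := eqVneq (r j) 0; first exact: (subring1 HR).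
by have [m ->] := posp_nat (r j); apply: (subringX HR); exact: Rx.
Qed.

Lemma exchange_poly_subring (R : set F) (A : set (group_ring P)) i :
  coeffs_in_ground iota A s -> is_subring R -> iota @` A `<=` R ->
  (forall j, B j i != 0 -> R (x j)) -> R (exchange_poly i).
Proof.
move=> Aco HR AR Rx.
have [Ap Am] := Aco s (mutation_class_foldl s [::]) i.
apply: (subringD HR); apply: (subringM HR).
- by apply: AR; exists (grU (coeffs s i / oplus 1 (coeffs s i))%g).
- exact: subring_monomial.
- by apply: AR; exists (grU (oplus 1 (coeffs s i))^-1%g).
- by apply: subring_monomial => // j; rewrite oppr_eq0; exact: Rx.
Qed.

End Adjacent.
End ExchangeRelation.

(** * Mutation along an independent set *)

Section IndependentMutation.
Context (P : semifieldType) (F : fieldType) (n : nat).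
Context (iota : {rmorphism group_ring P -> F}) (iota_inj : injective iota).
Variables (s : seed P F n) (A : set (group_ring P)).
Local Notation B := (exchange s).
Local Notation x := (cluster s).
Local Notation adj := (adjacent iota s).
Local Notation alg := (cluster_algebra iota A s).

(** Mutating at [i] in [S] changes an entry [(j, k)] of the exchange matrix with
    [k != i], and the coefficient [k], only when the entry [(i, k)] is nonzero.
    So it leaves the columns and coefficients of the other vertices of [S]
    unchanged, and with them their exchange relations. *)
Lemma cluster_mutate_independent (S : {set 'I_n}) ks :
  independent B S -> uniq ks -> {subset ks <= S} ->
  [/\ forall j, cluster (foldl (mutate iota) s ks) j =
        if j \in ks then adj j else x j,
      forall j k, k \in S -> k \notin ks ->
        exchange (foldl (mutate iota) s ks) j k = B j k
    & forall k, k \in S -> k \notin ks ->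
        coeffs (foldl (mutate iota) s ks) k = coeffs s k].
Proof.
move=> indS; elim/last_ind: ks => [//|ks i IHks].
rewrite rcons_uniq foldl_rcons => /andP[iks uks] sub.
have Si : i \in S by apply: sub; rewrite mem_rcons inE eqxx.
have [k kks|eqx eqB eqy] := IHks uks.
  by apply: sub; rewrite mem_rcons inE kks orbT.
set s' := foldl _ _ _ in eqx eqB eqy *.
split=> [j|j k Sk|k Sk]; rewrite mem_rcons inE.
- have -> : cluster (mutate iota s' i) j = mutx iota i s' j by [].
  have [->|ji] /= := eqVneq j i; last by rewrite mutxE (negPf ji).
  apply: eq_mutx => [k|||k Bki].
  + exact: eqB.
  + exact: eqy.
  + by rewrite eqx (negPf iks).
  + rewrite eqx; case: ifP => // kks; case/eqP: Bki; apply: indS => //.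
    by apply: sub; rewrite mem_rcons inE kks orbT.
- rewrite negb_or => /andP[ki kks]; rewrite /= mxE (negPf ki) orbF !eqB //.
  have [->|_] := eqVneq j i; first by rewrite (indS i k) ?oppr0.
  by rewrite (indS i k) // normr0 !mulr0 addr0.
- rewrite negb_or => /andP[ki kks]; rewrite /= ffunE (negPf ki) eqB // eqy //.
  by rewrite (indS i k) // !mulg1.
Qed.

Lemma alg_subring : is_subring alg.
Proof. exact: adjoin_subring. Qed.

Lemma alg_iota : iota @` A `<=` alg.
Proof. exact: adjoin_base. Qed.

Lemma alg_cluster j : alg (x j).
Proof.
apply: adjoin_gen; exists s; first exact: (mutation_class_foldl iota s [::]).
by exists j.
Qed.

Lemma alg_adjacent j : alg (adj j).
Proof.
apply: adjoin_gen; exists (mutate iota s j).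
  exact: (mutation_class_foldl iota s [:: j]).
by exists j.
Qed.

(** Ring generators attached to the index [j]: at the indices in [D] neither
    variable is inverted, at the other indices in [R] the Laurent polynomials
    are in the adjacent variable, elsewhere in the initial one. *)
Definition gens (D R : {set 'I_n}) j : set F :=
  if j \in D then [set x j; adj j]
  else if j \in R then [set adj j; (adj j)^-1] else [set x j; (x j)^-1].

Definition mixed_ring (D R : {set 'I_n}) : set F :=
  adjoin (iota @` A) [set a | exists j, gens D R j a].

Lemma gens_out (D R S : {set 'I_n}) k : D \subset S -> R \subset S ->
  k \notin S -> gens D R k = [set x k; (x k)^-1].
Proof.
move=> DS RS kS; rewrite /gens.
by rewrite !ifN //; apply: contra kS; exact: fintype.subsetP.
Qed.

Section Independent.
Variable S : {set 'I_n}.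
Hypothesis S_indep : independent B S.
Hypothesis x_free : freely_generates iota x.
Hypothesis A_coeffs : coeffs_in_ground iota A s.

Lemma cluster_neq0 j : x j != 0.
Proof.
exact: transcendental_neq0 (other_field_subring iota_inj x j)
  (@transcendental_other_field _ _ _ _ iota_inj _ j x_free).
Qed.

(** Mutating at the vertices of [R] leads to a cluster with this Laurent ring. *)
Lemma laurent_ring_mixed u : upper_cluster_algebra iota A s u ->
  forall R : {set 'I_n}, R \subset S -> mixed_ring finset.set0 R u.
Proof.
move=> Uu R /fintype.subsetP RS.
have := Uu _ (mutation_class_foldl iota s (enum R)).
have sub : {subset enum R <= S} by move=> i; rewrite mem_enum; exact: RS.
have [eqx _ _] := cluster_mutate_independent S_indep (enum_uniq R) sub.
apply: adjoin_min; [exact: adjoin_subring|exact: adjoin_base|].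
move=> a [] [j _ <-]; apply: adjoin_gen; exists j;
  rewrite eqx mem_enum /gens finset.in_set0.
  by case: ifP; left.
by case: ifP; right.
Qed.

Lemma column_out i k : i \in S -> B k i != 0 -> k \notin S.
Proof. by move=> Si; apply: contraNN => Sk; rewrite S_indep. Qed.

Lemma column_neq i k : i \in S -> B k i != 0 -> k != i.
Proof. by move=> Si /(column_out Si); apply: contraNneq => ->. Qed.

(** Induction on the size of [D]: for [i] in [D], the membership of [u] in the
    mixed rings where [i] is of either Laurent type is known, and [laurent_cap]
    combines the two. *)
Lemma mixed_ringS u :
  (forall R : {set 'I_n}, R \subset S -> mixed_ring finset.set0 R u) ->
  forall D R : {set 'I_n}, D \subset S -> R \subset S -> mixed_ring D R u.
Proof.
move=> base D; move: {2}#|D| (leqnn #|D|) => m.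
elim: m D => [|m IHm] D.
  by rewrite leqn0 cards_eq0 => /eqP-> R _; exact: base.
move=> cD R DS RS; have [->|[i Di]] := finset.set_0Vmem D; first exact: base.
have Si : i \in S by exact: (fintype.subsetP DS).
have cDi : (#|D :\ i| <= m)%N.
  by rewrite (cardsD1 i D) Di add1n ltnS in cD.
have DiS : D :\ i \subset S.
  by apply: fintype.subset_trans DS; exact: finset.subsetDl.
(* [K] collects the generators at the indices other than [i]. *)
pose K := adjoin (iota @` A) [set a | exists2 j, j != i & gens D R j a].
have HK : is_subring K by exact: adjoin_subring.
have HL := other_field_subring iota_inj x i.
have mixed_sub D' R' y y' :
    (forall j, j != i -> gens D' R' j = gens D R j) ->
    gens D' R' i = [set y; y'] -> mixed_ring D' R' `<=` adjoin K [set y; y'].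
  move=> eqj eqi; apply: adjoin_min; first exact: adjoin_subring.
    by move=> a Aa; apply: adjoin_base; exact: adjoin_base.
  move=> a [j]; have [->|ji] := eqVneq j i.
    by rewrite eqi; exact: adjoin_gen.
  by rewrite eqj // => ga; apply: adjoin_base; apply: adjoin_gen; exists j.
have : adjoin K [set x i; adj i] u; last first.
  apply: adjoin_min; first exact: adjoin_subring.
    apply: adjoin_min; [exact: adjoin_subring|exact: adjoin_base|].
    by move=> a [j _ ga]; apply: adjoin_gen; exists j.
  by move=> a ga; apply: adjoin_gen; exists i; rewrite /gens Di.
have L_iota : iota @` A `<=` other_field iota x i.
  by move=> _ [p _ <-]; exact: other_field_iota.
have LV := @other_fieldV P F n iota iota_inj x i.
have L_adj j : j \in S -> j != i -> other_field iota x i (adj j).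
  move=> Sj ji; rewrite adjacentE; apply: (subringM HL).
    apply: (exchange_poly_subring A_coeffs HL L_iota) => k Bkj.
    apply: other_field_gen => //.
    by apply: contraNneq (column_out Sj Bkj) => ->.
  by apply: LV; exact: other_field_gen.
rewrite adjacentE; apply: (laurent_cap HK HL) => //.
- apply: adjoin_min => // a [j ji]; rewrite /gens.
  have Lx := other_field_gen iota_inj x ji.
  have La : (j \in S) -> other_field iota x i (adj j).
    by move=> Sj; exact: L_adj.
  case: ifP => [Dj|_].
    by case=> ->; [|apply: La; exact: (fintype.subsetP DS)].
  case: ifP => [Rj|_]; last by case=> -> //; exact: LV.
  by case=> ->; [|apply: LV]; apply: La; exact: (fintype.subsetP RS).
- exact: transcendental_other_field.
- apply: (exchange_poly_subring A_coeffs HK); first exact: adjoin_base.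
  move=> k Bki; apply: adjoin_gen; exists k; first exact: column_neq Bki.
  by rewrite (gens_out DS RS) ?(column_out Si) //; left.
- apply: (mixed_sub (D :\ i) (R :\ i)) (IHm _ cDi _ DiS _).
  + by move=> j ji; rewrite /gens !finset.in_setD1 ji.
  + by rewrite /gens !finset.in_setD1 eqxx.
  + by apply: fintype.subset_trans RS; exact: finset.subsetDl.
- rewrite -adjacentE; apply: (mixed_sub (D :\ i) (i |: R)) (IHm _ cDi _ DiS _).
  + by move=> j ji; rewrite /gens finset.in_setD1 finset.in_setU1 ji (negPf ji).
  + by rewrite /gens finset.in_setD1 finset.in_setU1 eqxx.
  + by rewrite finset.subUset RS finset.sub1set Si.
Qed.

Lemma mixed_ring_clear u : mixed_ring S finset.set0 u ->
  exists N, alg ((\prod_(j in ~: S) x j) ^+ N * u).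
Proof.
pose w := \prod_(j in ~: S) x j.
have Aw : alg w by apply: (subring_prod alg_subring) => j _; exact: alg_cluster.
have clear0 a : alg a -> exists N, alg (w ^+ N * a).
  by move=> Aa; exists 0; rewrite mul1r.
apply: (adjoin_min (Y := [set u | exists N, alg (w ^+ N * u)])).
- apply: is_subringP => /= [|a b [N AN] [M AM]|a b [N AN] [M AM]].
  + exact: clear0 (subring1 alg_subring).
  + exists (N + M)%N; rewrite mulrBr exprD; apply: (subringB alg_subring).
      rewrite mulrAC mulrC; apply: (subringM alg_subring) => //.
      exact: (subringX alg_subring).
    rewrite -mulrA; apply: (subringM alg_subring) => //.
    exact: (subringX alg_subring).
  + by exists (N + M)%N; rewrite exprD mulrACA; exact: (subringM alg_subring).
- by move=> a Aa; apply: clear0; exact: alg_iota.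
move=> a [j]; rewrite /gens finset.in_set0; case: ifP => Sj.
  by case=> ->; [exact: clear0 (alg_cluster j)|exact: clear0 (alg_adjacent j)].
case=> ->; first exact: clear0 (alg_cluster j).
exists 1%N; rewrite expr1 /w (bigD1 j) ?inE ?Sj //=.
have x0 := cluster_neq0 j.
rewrite mulrAC divff // mul1r.
by apply: (subring_prod alg_subring) => k _; exact: alg_cluster.
Qed.

End Independent.
End IndependentMutation.

(** * Acyclic source freezing seeds *)

Section AcyclicSourceFreezing.
Context (P : semifieldType) (F : fieldType) (n : nat).
Context (iota : {rmorphism group_ring P -> F}) (iota_inj : injective iota).
Variables (s : seed P F n) (A : set (group_ring P)).
Local Notation B := (exchange s).
Local Notation x := (cluster s).
Local Notation adj := (adjacent iota s).
Local Notation alg := (cluster_algebra iota A s).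
Hypothesis x_free : freely_generates iota x.
Hypothesis A_coeffs : coeffs_in_ground iota A s.
Hypothesis B_skew : skew_symmetrizable B.
Hypothesis s_acyclic : acyclic s.
Hypothesis s_freezing : source_freezing A s.

Let Halg : is_subring alg := alg_subring iota s A.

Definition divides_power (w m : F) : Prop :=
  exists N v, alg v /\ m * v = w ^+ N.

Lemma divides_powerM w m m' :
  divides_power w m -> divides_power w m' -> divides_power w (m * m').
Proof.
move=> [N [v [Av mv]]] [N' [v' [Av' mv']]]; exists (N + N')%N, (v * v').
by split; [exact: (subringM Halg)|rewrite mulrACA mv mv' exprD].
Qed.

Lemma divides_power1 w : divides_power w 1.
Proof. by exists 0%N, 1; split; [exact: (subring1 Halg)|rewrite mulr1]. Qed.

Lemma divides_powerX w m e : divides_power w m -> divides_power w (m ^+ e).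
Proof.
move=> wm; elim: e => [|e IHe]; first exact: divides_power1.
by rewrite exprS; exact: divides_powerM.
Qed.

Lemma divides_power_out (Z : {set 'I_n}) i :
  (forall k, k \in Z -> 0 <= B k i) ->
  divides_power (\prod_(j in ~: Z) x j) (out_monomial s i).
Proof.
move=> Zi; rewrite /out_monomial.
apply: (big_ind (divides_power _)) => [|m m'|j _].
- exact: divides_power1.
- exact: divides_powerM.
have [jZ|jZ] := boolP (j \in Z).
  by rewrite posp_le0 ?oppr_le0 ?Zi //; exact: divides_power1.
have [e ->] := posp_nat (- B j i); apply: divides_powerX.
exists 1%N, (\prod_(k in ~: Z | k != j) x k); split.
  by apply: (subring_prod Halg) => k _; exact: alg_cluster.
by rewrite expr1 [RHS](bigD1 j) ?finset.in_setC.
Qed.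

(** Induction on the size of [Z]. The independent case is [mixed_ring_clear];
    otherwise the exchange relation at a source [i] of [Z] writes the
    product of the monomial and a divisor of one of its powers as a combination
    of the monomials for [Z :\ i] and [Z :\ j]. *)
Lemma conductor_radical_monomial u : upper_cluster_algebra iota A s u ->
  forall Z : {set 'I_n}, conductor_radical alg u (\prod_(j in ~: Z) x j).
Proof.
move=> Uu Z; have [m cZ] := ubnP #|Z|; elim: m Z cZ => // m IHm Z cZ.
set w := \prod_(j in _) _.
have Aw Y : alg (\prod_(j in ~: Y) x j).
  by apply: (subring_prod Halg) => j _; exact: alg_cluster.
have [Z_indep|/(acyclic_source B_skew)] := pselect (independent B Z).
  split; first exact: Aw.
  apply: (mixed_ring_clear iota_inj x_free).
  apply: (mixed_ringS iota_inj Z_indep x_free A_coeffs) => //.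
    exact: laurent_ring_mixed.
  exact: finset.sub0set.
case=> [i c c0 ic ci|i [j [Zi Zj Bji Zle]]].
  by apply: s_acyclic; exists i, c.
have radZ k : k \in Z -> conductor_radical alg u (x k * w).
  move=> Zk; have : conductor_radical alg u (\prod_(l in ~: (Z :\ k)) x l).
    by apply: IHm; move: cZ; rewrite (cardsD1 k Z) Zk.
  by rewrite finset.setCD finset.setUC big_setU1 // finset.in_setC Zk.
have [e posE] := posp_gt0 Bji.
pose b := x j ^+ e * \prod_(k | k != j) x k ^ posp (B k i).
have Ab : alg b.
  apply: (subringM Halg); first by apply: (subringX Halg); exact: alg_cluster.
  apply: (subring_prod Halg) => k _.
  have [f ->] := posp_nat (B k i).
  by apply: (subringX Halg); exact: alg_cluster.
have inE : in_monomial s i = x j * b.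
  by rewrite /in_monomial (bigD1 j) //= posE mulrA -exprS.
have x0 := cluster_neq0 iota_inj x_free i.
have [Ap _] := A_coeffs (mutation_class_foldl iota s [::]) i.
pose p : F := iota (grU (coeffs s i / oplus 1 (coeffs s i))%g).
pose q : F := iota (grU (oplus (coeffs s i) 1%g)).
have Alp : alg p.
  by apply: alg_iota; exists (grU (coeffs s i / oplus 1 (coeffs s i))%g).
(* This is where the seed being source freezing matters. *)
have Alq : alg q by apply: alg_iota; exists (grU (oplus (coeffs s i) 1%g)).
have outE : out_monomial s i * w =
    (x i * w) * (q * adj i) + (x j * w) * (- q * p * b).
  have q0 : q != 0 by exact: iota_grU_neq0.
  have qV : iota (grU (oplus 1 (coeffs s i))^-1%g) = q^-1.
    by rewrite iota_grUV oplusC.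
  rewrite adjacentE /exchange_poly inE qV -/p.
  by field; rewrite x0 q0.
have [N [v [Av vE]]] := divides_power_out Zle.
apply: (@conductor_radicalX _ _ _ _ N.+1); first exact: Aw.
rewrite exprSr -vE mulrAC; apply: conductor_radicalM => //.
rewrite outE; apply: conductor_radicalD => //;
  apply: conductor_radicalM => //; try exact: radZ.
- by apply: (subringM Halg) => //; exact: alg_adjacent.
- do 2!apply: (subringM Halg) => //.
  exact: (subringN Halg).
Qed.

End AcyclicSourceFreezing.

Theorem theorem3p7 (P : semifieldType) (F : fieldType)
  (iota : {rmorphism group_ring P -> F}) (iota_inj : injective iota)
  (n : nat) (s : seed P F n) (A : set (group_ring P))
  (s_seed : is_seed iota s) (A_ground : ground_ring A)
  (A_laurent : laurent_phenomenon iota A s)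
  (A_coeffs : coeffs_in_ground iota A s)
  (s_acyclic : acyclic s) (s_freezing : source_freezing A s) :
  cluster_algebra iota A s = upper_cluster_algebra iota A s.
Proof.
case: s_seed => B_skew x_free; apply/seteqP; split=> u.
  by move=> Au s' /A_laurent [sub <-]; exact: sub.
move=> Uu; apply: conductor_radical1.
have := conductor_radical_monomial iota_inj x_free A_coeffs B_skew s_acyclic
  s_freezing Uu [set: 'I_n]%SET.
by rewrite finset.setCT big_set0.
Qed.
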